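(* Let $\mathcal{K}$ be a directed $2$-complex, $p$ a nonempty $1$-path in $\mathcal{K}$, $\nu$ a function from the set of edges of $\mathcal{K}$ to a set of (possibly infinite) cardinal numbers, and $\mathcal{K}_\nu$ the corresponding expansion of $\mathcal{K}$. Let $\widetilde{\mathcal{K}}_p$ be the universal $2$-cover of $\mathcal{K}$ with base $p$, with root $\tilde p$ and labelling map $\phi$, and let $\overline{\mathcal{K}}_{\nu,p}$ be the expansion of $\widetilde{\mathcal{K}}_p$ corresponding to the function $\tilde\nu\colon\tilde e\mapsto\nu(\phi(\tilde e))$. Then the kernel $\mathcal{A}$ of the natural homomorphism $\theta\colon\mathcal{D}(\mathcal{K}_\nu,p)\to\mathcal{D}(\mathcal{K},p)$ that collapses all leaves is isomorphic to the diagram group $\mathcal{D}(\overline{\mathcal{K}}_{\nu,p},\tilde p)$.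
   Context: A directed $2$-complex $\mathcal{K}$ consists of: a directed graph (each edge $e$ has an initial vertex $\iota(e)$ and a terminal vertex $\tau(e)$); a set of $2$-cells; for each $2$-cell $f$, two nonempty directed paths $\lceil f\rceil$ (top) and $\lfloor f\rfloor$ (bottom) in the graph with the same initial vertex and the same terminal vertex; and a fixed-point-free involution $f\mapsto f^{-1}$ on $2$-cells with $\lceil f^{-1}\rceil=\lfloor f\rfloor$, $\lfloor f^{-1}\rfloor=\lceil f\rceil$. One $2$-cell in each pair $\{f,f^{-1}\}$ is called positive; a positive $2$-cell with top $u$ and bottom $v$ has the form $u=v$. Adding a $2$-cell always means adding its inverse as well. A $1$-path is a (possibly empty) directed path in the graph; $\iota,\tau$ extend to $1$-paths. The Squier complex $\mathrm{Sq}(\mathcal{K})$ is the $2$-dimensional cell complex whose vertices are the nonempty $1$-paths; whose edges are the triples $(u,f,v)$, with $u,v$ $1$-paths and $f$ a $2$-cell such that $u\lceil f\rceil v$ is a $1$-path, going from $u\lceil f\rceil v$ to $u\lfloor f\rfloor v$, with $(u,f,v)^{-1}=(u,f^{-1},v)$; and which has, for every $(u,f,q,g,r)$ with $f,g$ $2$-cells and $u\lceil f\rceil q\lceil g\rceil r$ a $1$-path, a $2$-cell attached along the loop $(u,f,q\lceil g\rceil r)\,(u\lfloor f\rfloor q,g,r)\,(u,f,q\lfloor g\rfloor r)^{-1}\,(u\lceil f\rceil q,g,r)^{-1}$. For a nonempty $1$-path $w$, $\mathcal{D}(\mathcal{K},w)=\pi_1(\mathrm{Sq}(\mathcal{K}),w)$.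 Two $1$-paths are homotopic if they are equal or joined by an edge path in $\mathrm{Sq}(\mathcal{K})$. Expansion: $\mathcal{K}_\nu$ is obtained from $\mathcal{K}$ by adding, for each edge $e$, $\nu(e)$ positive $2$-cells of the form $e=e$; these new cells are called leaves. The homomorphism $\theta$ is induced by the map on edges of Squier complexes that sends $(u,f,v)$ to the trivial path at $u\lceil f\rceil v$ if $f^{\pm1}$ is a leaf, and to itself otherwise; it is a retraction of $\mathcal{D}(\mathcal{K}_\nu,p)$ onto $\mathcal{D}(\mathcal{K},p)$. Rooted $2$-tree with root $w$: a directed $2$-complex $\mathcal{M}$ such that (T1) for any vertex $o$ there is a $1$-path from $\iota(w)$ to $\tau(w)$ containing $o$; (T2) every two $1$-paths in $\mathcal{M}$ with the same endpoints are homotopic in $\mathcal{M}$; (T3) $\mathcal{D}(\mathcal{M},w)$ is trivial. Universal $2$-cover of $\mathcal{K}$ with base $p$: a directed $2$-complex $\widetilde{\mathcal{K}}_p$ with a labelling map $\phi\colon\widetilde{\mathcal{K}}_p\to\mathcal{K}$ (sending vertices to vertices, edges to edges, $2$-cells to $2$-cells, preserving $\iota$, $\tau$, tops, bottoms, inverses and positivity) such that (U1) $\widetilde{\mathcal{K}}_p$ is a rooted $2$-tree with a root $\tilde p$ satisfying $\phi(\tilde p)=p$; (U2) for any $1$-path $\tilde q$ in $\widetilde{\mathcal{K}}_p$ from $\iota(\tilde p)$ to $\tau(\tilde p)$, the map induced by $\phi$ from the set of triples $(\tilde u,\tilde f,\tilde v)$ with $\tilde u\lceil\tilde f\rceil\tilde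 v=\tilde q$ to the set of triples $(u,f,v)$ over $\mathcal{K}$ with $u\lceil f\rceil v=\phi(\tilde q)$ is bijective. It exists and is unique up to label-preserving isomorphism. *)

(* Defs.v *)
From HB Require Import structures.
From mathcomp Require Import all_boot.
From mathcomp Require Import boolp classical_sets functions.

Set Implicit Arguments.
Unset Strict Implicit.
Unset Printing Implicit Defensive.

Record digraph := Digraph {
  vertex : Type;
  edge : Type;
  init : edge -> vertex;
  term : edge -> vertex }.

(* [is_path x s y]: the edges of [s] form a directed path from [x] to [y].  The
   empty sequence is the trivial path at [x], for every vertex [x]. *)
Fixpoint is_path (G : digraph) (x : vertex G) (s : seq (edge G))
    (y : vertex G) : Prop :=
  if s is e :: s' then init e = x /\ is_path (term e) s' y else x = y.

Definition path_seq (G : digraph) (s : seq (edge G)) : Prop :=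
  exists x y, is_path x s y.

Definition parallel (G : digraph) (s t : seq (edge G)) : Prop :=
  exists x y, is_path x s y /\ is_path x t y.

Record npath (G : digraph) := NPath {
  npath_seq :> seq (edge G);
  npath_neq0 : npath_seq <> [::];
  npathP : path_seq npath_seq }.

Lemma npath_eq (G : digraph) (p q : npath G) : p = q :> seq _ -> p = q.
Proof.
case: p q => [p p0 pP] [q q0 qP] /= pq; case: q / pq q0 qP => q0 qP.
by rewrite (Prop_irrelevance p0 q0) (Prop_irrelevance pP qP).
Qed.

Lemma is_path_cat (G : digraph) (x y : vertex G) s t :
  is_path x (s ++ t) y <-> exists2 z, is_path x s z & is_path z t y.
Proof.
elim: s x => [|e s IHs] x /=; first by split=> [|[z <-]//]; exists x.
split=> [[ex /IHs[z sz zt]]|[z [ex sz] zt]]; first by exists z.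
by split=> //; apply/IHs; exists z.
Qed.

Lemma is_path_eqr (G : digraph) (x y z : vertex G) s :
  is_path x s y -> is_path x s z -> y = z.
Proof.
elim: s x => [|e s IHs] x /=; first by move=> <- <-.
by move=> [_ ?] [_ ?]; apply: IHs; eassumption.
Qed.

Lemma is_path_eql (G : digraph) (x x' y y' : vertex G) s : s <> [::] ->
  is_path x s y -> is_path x' s y' -> x = x'.
Proof. by case: s => //= e s _ [<- _] [<-]. Qed.

Record cell_complex := CellComplex {
  skeleton :> digraph;
  einv : edge skeleton -> edge skeleton;
  einvK : involutive einv;
  init_einv : forall e, init (einv e) = term e;
  face : Type;
  boundary : face -> seq (edge skeleton);
  boundaryP : forall c, exists x, is_path x (boundary c) x }.

Section FundamentalGroup.

Variable X : cell_complex.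
Implicit Types (x y z w : vertex X) (s t a b : seq (edge X)).

Lemma term_einv (e : edge X) : term (einv e) = init e.
Proof. by rewrite -init_einv einvK. Qed.

(* Homotopy relative to the endpoints [x] and [y] *)
Inductive homot x y : seq (edge X) -> seq (edge X) -> Prop :=
| HomotRefl s : is_path x s y -> homot x y s s
| HomotSym s t : homot x y s t -> homot x y t s
| HomotTrans s t a : homot x y s t -> homot x y t a -> homot x y s a
| HomotCancel s e t : is_path x (s ++ [:: e; einv e] ++ t) y ->
    homot x y (s ++ [:: e; einv e] ++ t) (s ++ t)
| HomotFace s c t : is_path x (s ++ boundary c ++ t) y ->
    homot x y (s ++ boundary c ++ t) (s ++ t).

Lemma boundary_end x y c : is_path x (boundary c) y -> x = y.
Proof.
have [z] := boundaryP c; case E: (boundary c) => [|e s] //= [ez sz] [ex sy].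
by rewrite -ex ez; case: s sz sy {E} => [-> //|f s] sz sy; apply: is_path_eqr sz sy.
Qed.

Lemma homot_path x y s t : homot x y s t -> is_path x s y /\ is_path x t y.
Proof.
elim=> {s t} [//|s t _ []//|s t a _ [? _] _ [_ ?]//|s e t|s c t] h; split=> //.
- case/is_path_cat: h => z sz /= [ez [_ tz]]; apply/is_path_cat; exists z => //.
  by rewrite -ez -term_einv.
- case/is_path_cat: h => z sz /is_path_cat[z' /boundary_end <- tz].
  by apply/is_path_cat; exists z.
Qed.

Lemma homot_whisker x z z' y a b s t : is_path x a z -> is_path z' b y ->
  homot z z' s t -> homot x y (a ++ s ++ b) (a ++ t ++ b).
Proof.
move=> pa pb h.
have pabs r : is_path z r z' -> is_path x (a ++ r ++ b) y.
  by move=> pr; apply/is_path_cat; exists z => //; apply/is_path_cat; exists z'.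
elim: h => {s t} [s h|s t _ h|s t r _ h _ h'|s e t h|s c t h].
- exact/HomotRefl/pabs.
- exact: HomotSym.
- exact: HomotTrans h h'.
- have := @HomotCancel x y (a ++ s) e (t ++ b); rewrite -!catA; apply.
  by move/pabs: h; rewrite -!catA.
- have := @HomotFace x y (a ++ s) c (t ++ b); rewrite -!catA; apply.
  by move/pabs: h; rewrite -!catA.
Qed.

Lemma homot_cat x z y s s' t t' : homot x z s s' -> homot z y t t' ->
  homot x y (s ++ t) (s' ++ t').
Proof.
move=> hs ht; have [_ ps'] := homot_path hs; have [pt _] := homot_path ht.
apply: (@HomotTrans _ _ _ (s' ++ t)).
  exact: (@homot_whisker x x z y [::] t).
by have := @homot_whisker x z y y s' [::] t t' ps' erefl ht; rewrite !cats0.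
Qed.

Definition pinv s := rev (map (@einv X) s).

Lemma pinvK : involutive pinv.
Proof.
move=> s; rewrite /pinv map_rev revK -map_comp -[RHS]map_id.
by apply: eq_map => e /=; rewrite einvK.
Qed.

Lemma pinv_path x y s : is_path x s y -> is_path y (pinv s) x.
Proof.
rewrite /pinv; elim: s x => [|e s IHs] x /=; first by move->.
case=> <- /IHs h; rewrite rev_cons -cats1; apply/is_path_cat.
by exists (term e) => //=; rewrite init_einv term_einv.
Qed.

Lemma homot_mulV x y s : is_path x s y -> homot x x (s ++ pinv s) [::].
Proof.
rewrite /pinv; elim: s x => [|e s IHs] x /=; first by move=> _; apply: HomotRefl.
case=> ex /[dup] ps /IHs h; rewrite rev_cons -cats1.
have pe : is_path (term e) [:: einv e] x by rewrite /= init_einv term_einv.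
apply: (@HomotTrans _ _ _ ([:: e] ++ [::] ++ [:: einv e])); last first.
  exact: (@HomotCancel x x [::] e [::]).
rewrite catA; have := @homot_whisker x (term e) (term e) x [:: e] [:: einv e].
by apply=> //=; rewrite ?init_einv ?term_einv.
Qed.

Variable w : vertex X.

Definition loop := {s : seq (edge X) | is_path w s w}.

Definition Loop s (h : is_path w s w) : loop :=
  exist (fun s => is_path w s w) s h.

HB.instance Definition _ := gen_eqMixin loop.
HB.instance Definition _ := gen_choiceMixin loop.

Definition loop_rel : rel loop :=
  fun s t : loop => `[< homot w w (sval s) (sval t) >].

Lemma loop_rel_refl : reflexive loop_rel.
Proof. by case=> s h; apply/asboolP/HomotRefl. Qed.

Lemma loop_rel_sym : symmetric loop_rel.
Proof. by move=> s t; apply/asboolP/asboolP; apply: HomotSym. Qed.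

Lemma loop_rel_trans : transitive loop_rel.
Proof. by move=> t s a /asboolP h /asboolP h'; apply/asboolP/(HomotTrans h). Qed.

Canonical loop_equiv := EquivRel loop_rel loop_rel_refl loop_rel_sym loop_rel_trans.

Definition pi1 := {eq_quot loop_equiv}%qT.

HB.instance Definition _ := Choice.on pi1.

Definition loop_class (s : loop) : pi1 := (\pi_pi1 s)%qT.

Lemma loop_classP (s t : loop) :
  loop_class s = loop_class t <-> homot w w (sval s) (sval t).
Proof.
split=> [/eqmodP/asboolP//|h]; exact/eqmodP/asboolP.
Qed.

Lemma loop_class_repr (x : pi1) : loop_class (repr x) = x.
Proof. exact: reprK. Qed.

Lemma loop_cat_proof (s t : loop) : is_path w (sval s ++ sval t) w.
Proof. by apply/is_path_cat; exists w; [case: s|case: t]. Qed.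

Definition loop1 : loop := @Loop [::] erefl.
Definition loop_cat (s t : loop) : loop := Loop (loop_cat_proof s t).
Definition loop_inv (s : loop) : loop := Loop (pinv_path (svalP s)).

Definition pi1_one : pi1 := loop_class loop1.
Definition pi1_mul (x y : pi1) : pi1 := loop_class (loop_cat (repr x) (repr y)).
Definition pi1_inv (x : pi1) : pi1 := loop_class (loop_inv (repr x)).

Lemma pi1_mulE (s t : loop) :
  pi1_mul (loop_class s) (loop_class t) = loop_class (loop_cat s t).
Proof.
by apply/loop_classP/homot_cat; apply/loop_classP; rewrite loop_class_repr.
Qed.

Lemma pi1_ind (P : pi1 -> Prop) :
  (forall s : loop, P (loop_class s)) -> forall x : pi1, P x.
Proof. by move=> h x; rewrite -(loop_class_repr x). Qed.

Lemma pi1_mulA : associative pi1_mul.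
Proof.
elim/pi1_ind=> s; elim/pi1_ind=> t; elim/pi1_ind=> a; rewrite !pi1_mulE.
by apply/loop_classP; rewrite /= catA; apply: HomotRefl;
  exact: (svalP (loop_cat (loop_cat s t) a)).
Qed.

Lemma pi1_mul1 : left_id pi1_one pi1_mul.
Proof.
elim/pi1_ind=> s; rewrite /pi1_one pi1_mulE.
by apply/loop_classP; apply: HomotRefl; apply: svalP s.
Qed.

Lemma pi1_mulr1 : right_id pi1_one pi1_mul.
Proof.
elim/pi1_ind=> s; rewrite /pi1_one pi1_mulE.
by apply/loop_classP; rewrite /= cats0; apply: HomotRefl; apply: svalP s.
Qed.

Lemma pi1_mulV : right_inverse pi1_one pi1_inv pi1_mul.
Proof.
move=> x; rewrite -{1}(loop_class_repr x) pi1_mulE; apply/loop_classP => /=.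
exact: homot_mulV (svalP (repr x)).
Qed.

Lemma pi1_mulVl : left_inverse pi1_one pi1_inv pi1_mul.
Proof.
move=> x; rewrite -{2}(loop_class_repr x) pi1_mulE; apply/loop_classP => /=.
rewrite -{2}(pinvK (sval (repr x))).
exact: homot_mulV (pinv_path (svalP (repr x))).
Qed.

HB.instance Definition _ :=
  isGroup.Build pi1 pi1_mulA pi1_mul1 pi1_mulr1 pi1_mulVl pi1_mulV.

End FundamentalGroup.

Record directed2complex := Directed2Complex {
  dgraph :> digraph;
  cell : Type;
  top : cell -> seq (edge dgraph);
  bot : cell -> seq (edge dgraph);
  cinv : cell -> cell;
  positive : cell -> bool;
  top_neq0 : forall f, top f <> [::];
  bot_neq0 : forall f, bot f <> [::];
  cell_parallel : forall f, parallel (top f) (bot f);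
  cinvK : involutive cinv;
  cinv_neq : forall f, cinv f <> f;
  top_cinv : forall f, top (cinv f) = bot f;
  bot_cinv : forall f, bot (cinv f) = top f;
  positive_cinv : forall f, positive (cinv f) = ~~ positive f }.

Section Squier.

Variable K : directed2complex.
Implicit Types (u v q r : seq (edge K)) (f g : cell K).

(* In a triple [(u, f, v)] the 1-paths [u] and [v] are given by their edges: when
   [u] or [v] is empty, the vertex it sits at is determined by [f]. *)
Record sq_edge := SqEdge {
  sq_left : seq (edge K);
  sq_cell : cell K;
  sq_right : seq (edge K);
  sq_edgeP : path_seq (sq_left ++ top sq_cell ++ sq_right) }.

Lemma sq_edge_eq (e e' : sq_edge) : sq_left e = sq_left e' ->
  sq_cell e = sq_cell e' -> sq_right e = sq_right e' -> e = e'.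
Proof.
case: e e' => [u f v h] [u' f' v' h'] /= eu ef ev.
case: u' / eu h'; case: f' / ef; case: v' / ev => h'.
by rewrite (Prop_irrelevance h h').
Qed.

Lemma path_seq_bot u f v : path_seq (u ++ top f ++ v) -> path_seq (u ++ bot f ++ v).
Proof.
move=> [x [y /is_path_cat[z uz /is_path_cat[z' fz vz]]]]; exists x, y.
apply/is_path_cat; exists z => //; apply/is_path_cat; exists z' => //.
have [a [b [ta tb]]] := cell_parallel f.
move: (is_path_eql (@top_neq0 _ f) fz ta) => za; rewrite -za in ta tb.
by rewrite (is_path_eqr fz ta).
Qed.

Lemma path_seq_top u f v : path_seq (u ++ bot f ++ v) -> path_seq (u ++ top f ++ v).
Proof. by rewrite -(top_cinv f) -(bot_cinv f) => /path_seq_bot. Qed.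

Lemma cat3_neq0 (T : Type) (u s v : seq T) : s <> [::] -> u ++ s ++ v <> [::].
Proof. by case: u s => [[]|]. Qed.

Definition sq_init (e : sq_edge) : npath K :=
  NPath (cat3_neq0 (u := sq_left e) (v := sq_right e) (@top_neq0 K (sq_cell e)))
    (sq_edgeP e).

Definition sq_term (e : sq_edge) : npath K :=
  NPath (cat3_neq0 (u := sq_left e) (v := sq_right e) (@bot_neq0 K (sq_cell e)))
    (path_seq_bot (sq_edgeP e)).

Lemma sq_inv_proof (e : sq_edge) :
  path_seq (sq_left e ++ top (cinv (sq_cell e)) ++ sq_right e).
Proof. by rewrite top_cinv; apply: path_seq_bot (sq_edgeP e). Qed.

Definition sq_inv (e : sq_edge) : sq_edge := SqEdge (sq_inv_proof e).

Definition sq_graph : digraph := Digraph sq_init sq_term.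

Record sq_face := SqFace {
  face_u : seq (edge K);
  face_f : cell K;
  face_q : seq (edge K);
  face_g : cell K;
  face_r : seq (edge K);
  sq_faceP : path_seq (face_u ++ top face_f ++ face_q ++ top face_g ++ face_r) }.

Section Boundary.

Variable c : sq_face.
Let u := face_u c.
Let f := face_f c.
Let q := face_q c.
Let g := face_g c.
Let r := face_r c.

Lemma face_edge1_proof : path_seq (u ++ top f ++ (q ++ top g ++ r)).
Proof. exact: sq_faceP. Qed.

Lemma face_edge2_proof : path_seq ((u ++ bot f ++ q) ++ top g ++ r).
Proof. by rewrite -!catA; apply/path_seq_bot/face_edge1_proof. Qed.

Lemma face_edge4_proof : path_seq ((u ++ top f ++ q) ++ top g ++ r).
Proof. by rewrite -!catA; apply: face_edge1_proof. Qed.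

Lemma face_edge3_proof : path_seq (u ++ top f ++ (q ++ bot g ++ r)).
Proof. by have := path_seq_bot face_edge4_proof; rewrite -!catA. Qed.

Definition face_edge1 : sq_edge := SqEdge face_edge1_proof.
Definition face_edge2 : sq_edge := SqEdge face_edge2_proof.
Definition face_edge3 : sq_edge := SqEdge face_edge3_proof.
Definition face_edge4 : sq_edge := SqEdge face_edge4_proof.

Definition sq_boundary : seq sq_edge :=
  [:: face_edge1; face_edge2; sq_inv face_edge3; sq_inv face_edge4].

Lemma sq_boundaryP : exists x, @is_path sq_graph x sq_boundary x.
Proof.
exists (sq_init face_edge1).
do 4?split=> //; apply: npath_eq => /=; by rewrite ?top_cinv ?bot_cinv -?catA.
Qed.

End Boundary.

Lemma sq_invK : involutive sq_inv.
Proof. by move=> e; apply: sq_edge_eq => //=; rewrite cinvK. Qed.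

Lemma sq_init_inv e : sq_init (sq_inv e) = sq_term e.
Proof. by apply: npath_eq; rewrite /= top_cinv. Qed.

Definition squier : cell_complex :=
  @CellComplex sq_graph sq_inv sq_invK sq_init_inv sq_face sq_boundary sq_boundaryP.

Definition diagram_group (w : npath K) := @pi1 squier w.

HB.instance Definition _ w := Group.on (diagram_group w).

Definition homotopic u v : Prop :=
  u = v \/ exists (p q : npath K) (l : seq (edge squier)),
    [/\ p = u :> seq _, q = v :> seq _ & @is_path squier p l q].

End Squier.

Section Expansion.

Variable K : directed2complex.
(* The cardinal [nu e] is given by a type of that cardinality. *)
Variable nu : edge K -> Type.

(* [inr (existT e i, true)] is the [i]-th leaf at [e], and
   [inr (existT e i, false)] its inverse. *)
Definition exp_cell : Type := cell K + {e : edge K & nu e} * bool.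

Definition exp_top (f : exp_cell) : seq (edge K) :=
  match f with inl f => top f | inr (l, _) => [:: tag l] end.
Definition exp_bot (f : exp_cell) : seq (edge K) :=
  match f with inl f => bot f | inr (l, _) => [:: tag l] end.
Definition exp_inv (f : exp_cell) : exp_cell :=
  match f with inl f => inl (cinv f) | inr (l, b) => inr (l, ~~ b) end.
Definition exp_positive (f : exp_cell) : bool :=
  match f with inl f => positive f | inr (_, b) => b end.

Lemma exp_top_neq0 f : exp_top f <> [::].
Proof. by case: f => [f|[]//]; apply: top_neq0. Qed.
Lemma exp_bot_neq0 f : exp_bot f <> [::].
Proof. by case: f => [f|[]//]; apply: bot_neq0. Qed.
Lemma exp_parallel f : parallel (exp_top f) (exp_bot f).
Proof.
case: f => [f|[l b]]; first exact: cell_parallel.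
by exists (init (tag l)), (term (tag l)).
Qed.
Lemma exp_invK : involutive exp_inv.
Proof. by move=> [f|[l b]] /=; rewrite ?cinvK ?negbK. Qed.
Lemma exp_inv_neq f : exp_inv f <> f.
Proof. by case: f => [f [] /cinv_neq//|[l []] []]. Qed.
Lemma exp_top_inv f : exp_top (exp_inv f) = exp_bot f.
Proof. by case: f => [f|[]//]; apply: top_cinv. Qed.
Lemma exp_bot_inv f : exp_bot (exp_inv f) = exp_top f.
Proof. by case: f => [f|[]//]; apply: bot_cinv. Qed.
Lemma exp_positive_inv f : exp_positive (exp_inv f) = ~~ exp_positive f.
Proof. by case: f => [f|[]//]; apply: positive_cinv. Qed.

Definition expansion : directed2complex :=
  Directed2Complex exp_top_neq0 exp_bot_neq0 exp_parallel exp_invK exp_inv_neq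
    exp_top_inv exp_bot_inv exp_positive_inv.

Definition collapse_edge (e : sq_edge expansion) : seq (sq_edge K) :=
  let: SqEdge u f v h := e in
  match f return path_seq (u ++ exp_top f ++ v) -> seq (sq_edge K) with
  | inl f => fun h => [:: @SqEdge K u f v h]
  | inr _ => fun=> [::]
  end h.

Definition collapse (s : seq (sq_edge expansion)) : seq (sq_edge K) :=
  flatten (map collapse_edge s).

Lemma collapse_cat s t : collapse (s ++ t) = collapse s ++ collapse t.
Proof. by rewrite /collapse map_cat flatten_cat. Qed.

Lemma collapse_edge_path (e : edge (squier expansion)) :
  @is_path (squier K) (init e) (collapse_edge e) (term e).
Proof.
by case: e => u [f|[l b]] v h /=; first split; apply: npath_eq.
Qed.

Lemma collapse_path (x y : npath K) (s : seq (edge (squier expansion))) :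
  @is_path (squier expansion) x s y -> @is_path (squier K) x (collapse s) y.
Proof.
elim: s x => //= e s IHs x [<- /IHs h]; rewrite /collapse /=; apply/is_path_cat.
by exists (sq_term e) => //; apply: (collapse_edge_path e).
Qed.

Lemma collapse_edge_inv (e : edge (squier expansion)) :
  collapse_edge (einv e) = map (@einv (squier K)) (collapse_edge e).
Proof.
by case: e => u [f|[l b]] v h //=; congr cons; apply: sq_edge_eq.
Qed.

Lemma collapse_edge_pinv (e : edge (squier expansion)) :
  collapse_edge (einv e) = pinv (X := squier K) (collapse_edge e).
Proof. by rewrite collapse_edge_inv; case: e => u [f|[l b]] v h. Qed.

Lemma collapse_face (x y : npath K) (c : face (squier expansion)) :
  @is_path (squier K) x (collapse (boundary c)) y ->
  @homot (squier K) x y (collapse (boundary c)) [::].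
Proof.
case: c => u [f|[l b]] q [g|[l' b']] r h.
- have h' : @path_seq K (u ++ top f ++ q ++ top g ++ r) by [].
  set s := collapse _; suff -> : s = @boundary (squier K) (@SqFace K u f q g r h').
    move=> hp; have := @HomotFace (squier K) x y [::] (@SqFace K u f q g r h') [::].
    by rewrite cats0; apply.
  by rewrite {}/s /collapse /=; do 4?[congr cons; first exact: sq_edge_eq].
- rewrite /collapse /=; set e1 := SqEdge _; set e3 := SqEdge _.
  have -> : e3 = sq_inv e1 by apply: sq_edge_eq.
  exact: (@HomotCancel (squier K) x y [::] e1 [::]).
- rewrite /collapse /=; set e2 := SqEdge _; set e4 := SqEdge _.
  have -> : e4 = sq_inv e2 by apply: sq_edge_eq.
  exact: (@HomotCancel (squier K) x y [::] e2 [::]).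
- by rewrite /collapse /= => p; apply: HomotRefl.
Qed.

Lemma collapse_homot (x y : npath K) (s t : seq (edge (squier expansion))) :
  @homot (squier expansion) x y s t ->
  @homot (squier K) x y (collapse s) (collapse t).
Proof.
elim=> {s t} [s h|s t _ h|s t a _ h _ h'|s e t h|s c t h].
- exact/HomotRefl/collapse_path.
- exact: HomotSym.
- exact: HomotTrans h h'.
- have [z ps /is_path_cat[z' pe pt]] := iffLR (is_path_cat _ _ _ _) h.
  rewrite !collapse_cat.
  have -> : collapse [:: e; einv e] =
      collapse_edge e ++ pinv (X := squier K) (collapse_edge e).
    by rewrite -collapse_edge_pinv /collapse /= cats0.
  have [ez [_ z'E]] := pe.
  have zz' : z' = z by rewrite -z'E -ez; apply: term_einv.
  apply: (@homot_whisker (squier K) x z z y _ _ _ [::]).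
  + exact: (collapse_path ps).
  + by rewrite -zz'; apply: (collapse_path pt).
  + by apply: homot_mulV; rewrite -ez; apply: (collapse_edge_path e).
- have [z ps /is_path_cat[z' pc pt]] := iffLR (is_path_cat _ _ _ _) h.
  rewrite !collapse_cat.
  apply: (@homot_whisker (squier K) x z z' y _ _ _ [::]).
  + exact: (collapse_path ps).
  + exact: (collapse_path pt).
  + exact/collapse_face/(collapse_path pc).
Qed.

Variable p : npath K.

(* [p] is used as a 1-path of [K] and of [expansion], whose graphs coincide. *)
Definition collapse_loop (s : @loop (squier expansion) p) : @loop (squier K) p :=
  Loop (collapse_path (svalP s)).

Definition theta_fun (x : diagram_group (K := expansion) p) : diagram_group p :=
  loop_class (collapse_loop (repr x)).

Lemma theta_funE (s : @loop (squier expansion) p) :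
  theta_fun (loop_class s) = loop_class (collapse_loop s).
Proof.
apply/loop_classP/collapse_homot; apply/loop_classP.
exact: loop_class_repr.
Qed.

Lemma theta_funM : {morph theta_fun : x y / (x * y)%g}.
Proof.
elim/pi1_ind=> s; elim/pi1_ind=> t; rewrite [(_ * _)%g]pi1_mulE !theta_funE.
rewrite [(_ * _)%g]pi1_mulE; congr loop_class.
by apply: eq_exist; apply: collapse_cat.
Qed.

HB.instance Definition _ :=
  isMultiplicative.Build (diagram_group (K := expansion) p) (diagram_group p)
    theta_fun theta_funM.

Definition theta :
    {multiplicative diagram_group (K := expansion) p -> diagram_group p} :=
  theta_fun.

End Expansion.

Section Kernel.

Local Open Scope group_scope.

Variables (G H : groupType) (f : {multiplicative G -> H}).

Definition in_kernel : pred G := fun x => f x == 1.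

Record kernel := Kernel { kernel_val : G; kernelP : in_kernel kernel_val }.

HB.instance Definition _ := [isSub for kernel_val].
HB.instance Definition _ := [Choice of kernel by <:].

Lemma in_kernel_closed : group_closed in_kernel.
Proof.
have f1 : f 1 = 1 by apply: (mulgI (f 1)); rewrite -gmulfM !mulg1.
split=> [|x y]; rewrite !unfold_in /in_kernel ?f1 // => /eqP fx /eqP fy.
apply/eqP; rewrite gmulfM fx mul1g.
by apply: (mulgI (f y)); rewrite -gmulfM mulgV f1 mulg1 fy.
Qed.

HB.instance Definition _ :=
  SubChoice_isSubGroup.Build G in_kernel kernel in_kernel_closed.

End Kernel.

Definition isomorphic (G H : groupType) : Prop :=
  exists f : {multiplicative G -> H}, bijective f.

Record rooted_2tree (M : directed2complex) (w : npath M) : Prop := Rooted2Tree {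
  tree_path : forall o : vertex M, exists x y s t,
    [/\ is_path x w y, is_path x s o & is_path o t y];
  tree_homotopic : forall s t : seq (edge M), parallel s t -> homotopic s t;
  tree_trivial : forall x : diagram_group w, x = 1%g }.

Record labelling (L K : directed2complex) := Labelling {
  lab_vertex : vertex L -> vertex K;
  lab_edge : edge L -> edge K;
  lab_cell : cell L -> cell K;
  lab_init : forall e, lab_vertex (init e) = init (lab_edge e);
  lab_term : forall e, lab_vertex (term e) = term (lab_edge e);
  lab_top : forall f, map lab_edge (top f) = top (lab_cell f);
  lab_bot : forall f, map lab_edge (bot f) = bot (lab_cell f);
  lab_inv : forall f, lab_cell (cinv f) = cinv (lab_cell f);
  lab_positive : forall f, positive (lab_cell f) = positive f }.

Local Open Scope classical_set_scope.

Definition triples (K : directed2complex) (q : seq (edge K)) :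
    set (seq (edge K) * cell K * seq (edge K)) :=
  [set t | t.1.1 ++ top t.1.2 ++ t.2 = q].

Definition lab_triple (L K : directed2complex) (phi : labelling L K)
    (t : seq (edge L) * cell L * seq (edge L)) :=
  (map (lab_edge phi) t.1.1, lab_cell phi t.1.2, map (lab_edge phi) t.2).

Record universal_2cover (K : directed2complex) (p : npath K)
    (L : directed2complex) (phi : labelling L K) (pt : npath L) : Prop :=
  Universal2Cover {
    cover_tree : rooted_2tree pt;
    cover_root : map (lab_edge phi) pt = p;
    cover_bij : forall q : seq (edge L), parallel pt q ->
      set_bij (triples q) (triples (map (lab_edge phi) q)) (lab_triple phi) }.

(* Main.v *)
Require Import Defs.
From HB Require Import structures.
From mathcomp Require Import all_boot.
From mathcomp Require Import boolp classical_sets functions.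

(** The labelling map [phi] makes the component of [pt] in the Squier complex of
    the universal 2-cover a covering of the component of [p] in the Squier complex
    of [K].  Adding leaves attaches loops, which lift to loops, so the expansions
    are again related by a covering; it induces an injection of diagram groups whose
    image consists of the loops with closed lift.  The endpoint of a lift is not
    changed by collapsing leaves, and as the Squier complex of the 2-cover is
    simply connected, a collapsed loop has a closed lift iff it is null-homotopic. *)

Set Implicit Arguments.
Unset Strict Implicit.
Unset Printing Implicit Defensive.

Lemma map_eq_cat (T U : Type) (h : T -> U) (r : seq T) (s t : seq U) :
  map h r = s ++ t -> exists r1 r2, [/\ r = r1 ++ r2, map h r1 = s & map h r2 = t].
Proof.
move=> rE; exists (take (size s) r), (drop (size s) r).
by rewrite cat_take_drop map_take map_drop rE take_size_cat ?drop_size_cat.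
Qed.

(** * Coverings of cell complexes: lifting of paths and homotopies, and the induced map of
    fundamental groups *)

Section Covering.

Variables X Y : cell_complex.

Record complex_map := ComplexMap {
  cm_vertex : vertex X -> vertex Y;
  cm_edge : edge X -> edge Y;
  cm_init : forall e, init (cm_edge e) = cm_vertex (init e);
  cm_term : forall e, term (cm_edge e) = cm_vertex (term e);
  cm_einv : forall e, cm_edge (einv e) = einv (cm_edge e);
  cm_face : face X -> face Y;
  cm_boundary : forall c, boundary (cm_face c) = map cm_edge (boundary c) }.

(* [D] is a union of connected components of [X]; [f] covers its image there. *)
Record covering_on (D : vertex X -> Prop) (f : complex_map) : Prop := CoveringOn {
  cov_closed : forall e, D (init e) -> D (term e);
  cov_lift : forall x e, D x -> init e = cm_vertex f x ->
    exists2 e', init e' = x & cm_edge f e' = e;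
  cov_uniq : forall e e', D (init e) -> init e = init e' ->
    cm_edge f e = cm_edge f e' -> e = e';
  cov_face : forall x y c, D x -> is_path (cm_vertex f x) (boundary c) y ->
    exists2 c', is_path x (boundary c') x & map (cm_edge f) (boundary c') = boundary c }.

Variable f : complex_map.
Implicit Types (x y z : vertex X).

Lemma cm_path x y s : is_path x s y ->
  is_path (cm_vertex f x) (map (cm_edge f) s) (cm_vertex f y).
Proof.
elim: s x => [|e s IHs] x /=; first by move->.
by case=> <- /IHs; rewrite cm_init cm_term.
Qed.

Lemma cm_homot x y s t : homot x y s t ->
  homot (cm_vertex f x) (cm_vertex f y) (map (cm_edge f) s) (map (cm_edge f) t).
Proof.
elim=> {s t} [s h|s t _ h|s t a _ h _ h'|s e t /cm_path|s c t /cm_path].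
- exact/HomotRefl/cm_path.
- exact: HomotSym.
- exact: HomotTrans h h'.
- by rewrite !map_cat /= cm_einv; apply: HomotCancel.
- by rewrite !map_cat -cm_boundary; apply: HomotFace.
Qed.

Variable D : vertex X -> Prop.
Hypothesis cov : covering_on D f.

Lemma covering_closed x y s : D x -> is_path x s y -> D y.
Proof.
elim: s x => [|e s IHs] x /= Dx; first by move=> <-.
by case=> ex; apply: IHs; apply: (cov_closed cov); rewrite ex.
Qed.

Lemma covering_path_lift x s (y : vertex Y) : D x -> is_path (cm_vertex f x) s y ->
  exists s' y', is_path x s' y' /\ map (cm_edge f) s' = s.
Proof.
elim: s x => [|e s IHs] x Dx /=; first by exists [::], x.
case=> /(cov_lift cov Dx)[e' ex <-]; rewrite cm_term.
have Dt : D (term e') by apply: (cov_closed cov); rewrite ex.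
by case/(IHs _ Dt) => s' [y' [ps' <-]]; exists (e' :: s'), y'.
Qed.

Lemma covering_path_uniq x y z s t : D x -> is_path x s y -> is_path x t z ->
  map (cm_edge f) s = map (cm_edge f) t -> s = t.
Proof.
elim: s t x => [|e s IHs] [|e' t] x //= Dx [ex ps] [ex' pt] [ee st].
have eE : e = e' by apply: (cov_uniq cov); rewrite ?ex.
rewrite -eE in pt *; congr cons; apply: IHs ps pt st.
by apply: (cov_closed cov); rewrite ex.
Qed.

(** The lift of [t] must end at the same [y] as that of [s]: this records that the endpoint of a
    lift depends only on the homotopy class. *)
Definition homot_lifts (v : vertex Y) (s t : seq (edge Y)) :=
  forall x y s', D x -> cm_vertex f x = v -> is_path x s' y ->
  map (cm_edge f) s' = s -> exists2 t', map (cm_edge f) t' = t & homot x y s' t'.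

(** Treats both elementary moves at once: [a] stands for a pair of inverse edges or the boundary of
    a face, and its lifts only have to be null-homotopic. *)
Lemma homot_lifts_insert (v v' : vertex Y) (s a t : seq (edge Y)) :
    is_path v s v' -> is_path v' a v' ->
    (forall x, D x -> cm_vertex f x = v' ->
       exists2 a', map (cm_edge f) a' = a & homot x x a' [::]) ->
  homot_lifts v (s ++ a ++ t) (s ++ t) /\ homot_lifts v (s ++ t) (s ++ a ++ t).
Proof.
move=> ps pa aP.
have sP x y r : cm_vertex f x = v -> is_path x r y -> map (cm_edge f) r = s ->
    cm_vertex f y = v'.
  by move=> xv /cm_path + rE; rewrite rE xv => /is_path_eqr; apply.
split=> x y r Dx xv /[swap].
- case/map_eq_cat=> r1 [r23 [-> r1E /map_eq_cat[r2 [r3 [-> r2E r3E]]]]].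
  case/is_path_cat=> z p1 /is_path_cat[z' p2 p3].
  have Dz := covering_closed Dx p1; have zv := sP _ _ _ xv p1 r1E.
  have [a' a'E ha'] := aP _ Dz zv; have [pa' _] := homot_path ha'.
  (* Unique lifting identifies the middle piece of the given lift with [a']; hence it is closed and
     can be removed. *)
  have aa' : r2 = a' by apply: covering_path_uniq Dz p2 pa' _; rewrite a'E.
  have zz' : z' = z by rewrite aa' in p2; apply: is_path_eqr p2 pa'.
  exists (r1 ++ r3); first by rewrite map_cat r1E r3E.
  by rewrite aa'; rewrite zz' in p3; apply: (homot_whisker p1 p3 ha').
- case/map_eq_cat=> r1 [r3 [-> r1E r3E]] /is_path_cat[z p1 p3].
  have Dz := covering_closed Dx p1; have zv := sP _ _ _ xv p1 r1E.
  have [a' a'E ha'] := aP _ Dz zv.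
  exists (r1 ++ a' ++ r3); first by rewrite !map_cat r1E a'E r3E.
  exact/HomotSym/(homot_whisker p1 p3 ha').
Qed.

(** Induction on the homotopy. Both directions are carried along because the symmetry rule exchanges
    them. *)
Lemma covering_homot_lift (v w : vertex Y) (s t : seq (edge Y)) :
  homot v w s t -> homot_lifts v s t /\ homot_lifts v t s.
Proof.
elim=> {s t} [s h|s t _ []//|s t a _ [st ts] _ [ta at_]|s e t|s c t].
- by split=> x y r _ _ pr rs; exists r => //; apply: HomotRefl.
- split=> x y r Dx xv pr.
  + case/(st _ _ _ Dx xv pr) => r' /ta h rr'; have [_ pr'] := homot_path rr'.
    by have [r'' ? ?] := h _ _ Dx xv pr'; exists r'' => //; apply: HomotTrans rr' _.
  + case/(at_ _ _ _ Dx xv pr) => r' /ts h rr'; have [_ pr'] := homot_path rr'.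
    by have [r'' ? ?] := h _ _ Dx xv pr'; exists r'' => //; apply: HomotTrans rr' _.
- case/is_path_cat=> v' ps [ev' _]; apply: homot_lifts_insert ps _ _.
    by rewrite /= init_einv term_einv.
  move=> x Dx xv; have [|e' e'x e'e] := cov_lift (e := e) cov Dx; first by rewrite xv.
  exists [:: e'; einv e']; first by rewrite /= cm_einv e'e.
  apply: (@HomotCancel _ x x [::] e' [::]).
  by rewrite /= init_einv term_einv.
- case/is_path_cat=> v' ps /is_path_cat[v'' pc _].
  have vE := boundary_end pc; rewrite -vE in pc.
  apply: (homot_lifts_insert _ ps pc) => x Dx xv; rewrite -xv in pc.
  have [c' pc' c'c] := cov_face cov Dx pc.
  exists (boundary c') => //; have := @HomotFace _ x x [::] c' [::].
  by rewrite cats0; apply.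
Qed.

Variables (w : vertex X) (w' : vertex Y).
Hypothesis ww' : cm_vertex f w = w'.

Lemma loop_map_proof (s : loop w) : is_path w' (map (cm_edge f) (sval s)) w'.
Proof. by rewrite -ww'; apply/cm_path/(svalP s). Qed.

Definition loop_map (s : loop w) : loop w' := Loop (loop_map_proof s).

Definition pi1_map (x : pi1 w) : pi1 w' := loop_class (loop_map (repr x)).

Lemma pi1_mapE (s : loop w) : pi1_map (loop_class s) = loop_class (loop_map s).
Proof.
apply/loop_classP => /=; rewrite -ww'; apply/cm_homot/loop_classP.
exact: loop_class_repr.
Qed.

Lemma pi1_mapM : {morph pi1_map : x y / (x * y)%g}.
Proof.
elim/pi1_ind=> s; elim/pi1_ind=> t; rewrite [(_ * _)%g]pi1_mulE !pi1_mapE.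
rewrite [(_ * _)%g]pi1_mulE; congr loop_class.
by apply: eq_exist; apply: map_cat.
Qed.

(** A homotopy between the images lifts to one from [s] to some lift of the image of [t], which by
    unique lifting is [t] itself. *)
Lemma pi1_map_inj : D w -> injective pi1_map.
Proof.
move=> Dw; elim/pi1_ind=> s; elim/pi1_ind=> t; rewrite !pi1_mapE.
move/loop_classP/covering_homot_lift=> [h _].
have [t' t't st'] := h _ _ _ Dw ww' (svalP s) erefl; have [_ pt'] := homot_path st'.
apply/loop_classP; rewrite (covering_path_uniq Dw (svalP t) pt') //; exact: esym.
Qed.

End Covering.

(** * The covering of Squier complexes induced by a labelling *)

Lemma cat_eq_size (T : Type) (s s' t t' : seq T) :
  size s = size s' -> s ++ t = s' ++ t' -> s = s' /\ t = t'.
Proof.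
move=> ss E; split.
  by have := congr1 (take (size s)) E; rewrite !take_size_cat.
by have := congr1 (drop (size s)) E; rewrite !drop_size_cat.
Qed.

Lemma sq_face_eq (K : directed2complex) (c c' : sq_face K) :
  face_u c = face_u c' -> face_f c = face_f c' -> face_q c = face_q c' ->
  face_g c = face_g c' -> face_r c = face_r c' -> c = c'.
Proof.
case: c c' => [u f q g r h] [u' f' q' g' r' h'] /= eu ef eq eg er.
by subst; rewrite (Prop_irrelevance h h').
Qed.

(** Sharpens [path_seq_bot] by keeping the endpoints, so that the 1-paths parallel to the root are
    closed under edges of the Squier complex. *)
Lemma is_path_bot (K : directed2complex) (x y : vertex K) u (f : cell K) v :
  is_path x (u ++ top f ++ v) y -> is_path x (u ++ bot f ++ v) y.
Proof.
case/is_path_cat=> z pu /is_path_cat[z' pf pv].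
apply/is_path_cat; exists z => //; apply/is_path_cat; exists z' => //.
have [a [b [ta tb]]] := cell_parallel f.
have za := is_path_eql (@top_neq0 _ f) pf ta; rewrite -za in ta tb.
by rewrite (is_path_eqr pf ta).
Qed.

Section SquierMap.

Variables (L K : directed2complex) (phi : labelling L K).
Local Notation lab := (map (lab_edge phi)).

Lemma lab_path x y s : is_path x s y ->
  is_path (lab_vertex phi x) (lab s) (lab_vertex phi y).
Proof.
by elim: s x => [|e s IHs] x /=; [move->|case=> <- /IHs; rewrite lab_init lab_term].
Qed.

Lemma lab_path_seq s : path_seq s -> path_seq (lab s).
Proof. by case=> x [y /lab_path]; exists (lab_vertex phi x), (lab_vertex phi y). Qed.

Lemma lab_neq0 s : s <> [::] -> lab s <> [::].
Proof. by case: s. Qed.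

Definition npath_map (q : npath L) : npath K :=
  NPath (lab_neq0 (npath_neq0 (n := q))) (lab_path_seq (npathP q)).

Lemma sq_edge_map_proof (e : sq_edge L) :
  path_seq (lab (sq_left e) ++ top (lab_cell phi (sq_cell e)) ++ lab (sq_right e)).
Proof. by rewrite -lab_top -!map_cat; apply/lab_path_seq/sq_edgeP. Qed.

Definition sq_edge_map (e : sq_edge L) : sq_edge K := SqEdge (sq_edge_map_proof e).

Lemma sq_face_map_proof (c : sq_face L) :
  path_seq (lab (face_u c) ++ top (lab_cell phi (face_f c)) ++ lab (face_q c) ++
            top (lab_cell phi (face_g c)) ++ lab (face_r c)).
Proof. by rewrite -!lab_top -!map_cat; apply/lab_path_seq/sq_faceP. Qed.

Definition sq_face_map (c : sq_face L) : sq_face K := SqFace (sq_face_map_proof c).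

Lemma sq_edge_map_init e : sq_init (sq_edge_map e) = npath_map (sq_init e).
Proof. by apply: npath_eq; rewrite /= !map_cat lab_top. Qed.

Lemma sq_edge_map_term e : sq_term (sq_edge_map e) = npath_map (sq_term e).
Proof. by apply: npath_eq; rewrite /= !map_cat lab_bot. Qed.

Lemma sq_edge_map_inv e : sq_edge_map (sq_inv e) = sq_inv (sq_edge_map e).
Proof. by apply: sq_edge_eq => //=; rewrite lab_inv. Qed.

Lemma sq_boundary_map c : sq_boundary (sq_face_map c) = map sq_edge_map (sq_boundary c).
Proof.
rewrite /= !sq_edge_map_inv.
by do 4?[congr cons; try congr sq_inv; first by apply: sq_edge_eq;
  rewrite //= !map_cat ?lab_top ?lab_bot].
Qed.

Definition squier_map : complex_map (squier L) (squier K) :=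
  @ComplexMap (squier L) (squier K) npath_map sq_edge_map sq_edge_map_init
    sq_edge_map_term sq_edge_map_inv sq_face_map sq_boundary_map.

Lemma lab_triple_fun q : set_fun (triples q) (triples (lab q)) (lab_triple phi).
Proof. by case=> [[u f] v] <-; rewrite /triples /= !map_cat lab_top. Qed.

Variable pt : npath L.
Hypothesis triples_bij : forall q : seq (edge L), parallel pt q ->
  set_bij (triples q) (triples (lab q)) (lab_triple phi).

Lemma lab_sq_edge_lift (q : npath L) (e : sq_edge K) : parallel pt q ->
  sq_init e = npath_map q -> exists2 e', sq_init e' = q & sq_edge_map e' = e.
Proof.
move=> Dq; case: e => u f v h eq.
have /= ufv : u ++ top f ++ v = lab q := congr1 (@npath_seq K) eq.
case: (triples_bij Dq) => _ _ /(_ (u, f, v) ufv)[[[u' f'] v'] /= q' [uE fE vE]].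
have h' : path_seq (u' ++ top f' ++ v') by rewrite q'; apply: npathP.
by exists (SqEdge h'); [apply: npath_eq|apply: sq_edge_eq].
Qed.

(** The edges leaving a vertex [q] of the Squier complex are the triples of [q], so [triples_bij] is
    the bijection on stars: its surjectivity lifts edges, its injectivity makes the lifts unique.
    Only the lifting of faces needs a further argument. *)
Lemma squier_covering : covering_on (fun q : vertex (squier L) => parallel pt q) squier_map.
Proof.
split=> [e|x e|e e' De ee' /= E|x y c Dx].
- by case=> x [y [ptp /is_path_bot pe]]; exists x, y.
- exact: lab_sq_edge_lift.
- have [_ inj _] := triples_bij De.
  have [uE fE vE] : (sq_left e, sq_cell e, sq_right e) =
      (sq_left e', sq_cell e', sq_right e').
    have tri (d : sq_edge L) : sq_init d = init e ->
        (sq_left d, sq_cell d, sq_right d) \in triples (init e).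
      by move=> <-; rewrite inE.
    apply: inj; [exact: tri|exact/tri/esym|].
    congr (_, _, _).
    - by have := congr1 (@sq_left K) E.
    - by have := congr1 (@sq_cell K) E.
    - by have := congr1 (@sq_right K) E.
  exact: sq_edge_eq.
  (* Both applications [f] and [g] at [npath_map x] lift to [x]; comparing lengths
     shows that the lifts are disjoint, hence span a face. *)
- case=> cx _; have [[u f v h] ex eE] := lab_sq_edge_lift Dx cx.
  have cx' : sq_init (face_edge4 c) = npath_map x.
    by apply: etrans cx; apply: npath_eq; rewrite /= -!catA.
  have [[u' g r h'] ex' eE'] := lab_sq_edge_lift Dx cx'.
  have /= uE := congr1 (@sq_left K) eE; have /= fE := congr1 (@sq_cell K) eE.
  have /= u'E := congr1 (@sq_left K) eE'; have /= gE := congr1 (@sq_cell K) eE'.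
  have /= rE := congr1 (@sq_right K) eE'.
  case/map_eq_cat: u'E => u1 [u2 [E u1E /map_eq_cat[t [q [E2 tE qE]]]]].
  have /= xE := congr1 (@npath_seq L) ex; have /= xE' := congr1 (@npath_seq L) ex'.
  have : u ++ top f ++ v = u1 ++ t ++ q ++ top g ++ r.
    by rewrite xE -xE' E E2 -!catA.
  case/cat_eq_size; first by rewrite -(size_map (lab_edge phi)) uE -u1E size_map.
  move=> _ /cat_eq_size[|_ vE].
    by rewrite -(size_map (lab_edge phi)) lab_top fE -tE size_map.
  have hc := h; rewrite vE in hc; pose c' := SqFace hc.
  have c'E : sq_face_map c' = c by apply: sq_face_eq.
  exists c'; last by rewrite -[RHS]/(sq_boundary c) -c'E sq_boundary_map.
  have [x' px'] := sq_boundaryP c'; suff -> : x = x' by [].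
  by case: px' => <- _; rewrite -ex; apply: npath_eq; rewrite /= vE.
Qed.

End SquierMap.

(** * Extension of the labelling to the expansions *)

Section ExpansionMap.

Variables (L K : directed2complex) (phi : labelling L K) (nu : edge K -> Type).
Local Notation lab := (map (lab_edge phi)).
Local Notation nut := (fun e : edge L => nu (lab_edge phi e)).

(** The index [i] is kept without transport, since the leaves at [e] are by definition indexed by
    the type of leaves at its label. *)
Definition exp_lab_cell (f : exp_cell nut) : exp_cell nu :=
  match f with
  | inl f => inl (lab_cell phi f)
  | inr (existT e i, b) => inr (existT nu (lab_edge phi e) i, b)
  end.

Lemma exp_lab_top f : lab (exp_top f) = exp_top (exp_lab_cell f).
Proof. by case: f => [f|[[e i] b]] //; apply: lab_top. Qed.

Lemma exp_lab_bot f : lab (exp_bot f) = exp_bot (exp_lab_cell f).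
Proof. by case: f => [f|[[e i] b]] //; apply: lab_bot. Qed.

Lemma exp_lab_inv f : exp_lab_cell (exp_inv f) = exp_inv (exp_lab_cell f).
Proof. by case: f => [f|[[e i] b]] //=; rewrite lab_inv. Qed.

Lemma exp_lab_positive f : exp_positive (exp_lab_cell f) = exp_positive f.
Proof. by case: f => [f|[[e i] b]] //; apply: lab_positive. Qed.

Definition exp_labelling : labelling (expansion nut) (expansion nu) :=
  @Labelling (expansion nut) (expansion nu) (lab_vertex phi) (lab_edge phi) exp_lab_cell
    (@lab_init _ _ phi) (@lab_term _ _ phi) exp_lab_top exp_lab_bot exp_lab_inv
    exp_lab_positive.

(** A leaf triple of [q] amounts to a position in [q], an index and a sign, and the labelling
    preserves all three. *)
Lemma exp_triples_bij (q : seq (edge L)) :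
  set_bij (triples q) (triples (lab q)) (lab_triple phi) ->
  set_bij (@triples (expansion nut) q) (@triples (expansion nu) (lab q))
    (lab_triple exp_labelling).
Proof.
case=> _ inj surj; split.
- exact: (@lab_triple_fun _ _ exp_labelling).
- move=> [[u [f|[[e i] b]]] v] [[u' [f'|[[e' i'] b']]] v'] //;
    rewrite !inE /triples /= => tq tq' [] uE.
  + move=> fE vE; have [-> -> ->] : (u, f, v) = (u', f', v'); last by [].
    apply: inj; rewrite ?inE //.
    by rewrite /lab_triple /= uE fE vE.
  + rewrite -{}tq' in tq; case/cat_eq_size: tq.
      by rewrite -(size_map (lab_edge phi)) uE size_map.
    move=> -> [eE ->]; case: e' / eE i' => i' _ E -> _.
    by have := projT2_eq E; rewrite (Prop_irrelevance (projT1_eq E) erefl) /= => ->.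
- move=> [[u [f|[[e i] b]]] v] tq.
  + have [[[u' f'] v'] tq' E] := surj (u, f, v) tq; exists (u', inl f', v') => //.
    by case: E => <- <- <-.
  (* The leaf sits at one edge of [lab q]; its preimage is the leaf of the same index and sign at
     the corresponding edge of [q]. *)
  + move: tq; rewrite /triples /= => /esym/map_eq_cat[u' [[|e' v'] [-> <- //= [eE <-]]]].
    by case: e / eE i => i; exists (u', inr (existT _ e' i, b), v').
Qed.

(** This commuting square lets lifts be compared before and after the collapse of leaves. *)
Lemma collapse_map s : collapse (map (sq_edge_map exp_labelling) s) =
  map (sq_edge_map phi) (collapse s).
Proof.
rewrite /collapse; elim: s => //= e s ->; rewrite map_cat; congr cat.
by case: e => u [f|[[e i] b]] v h //; congr cons; apply: sq_edge_eq.
Qed.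

End ExpansionMap.

(** * Identification of the kernel *)

Lemma isomorphic_kernel (G H D : groupType) (f : {multiplicative G -> H}) (g : D -> G) :
    {morph g : x y / (x * y)%g} -> injective g ->
    (forall x, in_kernel f x <-> exists y, g y = x) ->
  isomorphic (kernel f) D.
Proof.
move=> gM g_inj fg.
have gP (x : kernel f) : {y | g y = kernel_val x} by apply/cid/fg/kernelP.
(* The isomorphism is the inverse of [g] on its image; the choice of preimage is harmless as [g] is
   injective, which also makes [h] multiplicative. *)
pose h x := sval (gP x); have hP x : g (h x) = kernel_val x := svalP (gP x).
have hM : {morph h : x y / (x * y)%g} by move=> x y; apply: g_inj; rewrite gM !hP.
pose hmul := isMultiplicative.Build _ _ h hM.
pose hm : {multiplicative kernel f -> D} := HB.pack h hmul.
exists hm; have kP y : in_kernel f (g y) by apply/fg; exists y.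
exists (fun y => Kernel (kP y)) => [x|y].
  by apply: val_inj; rewrite /= hP.
by apply: g_inj; rewrite hP.
Qed.

Theorem theorem3p1 (K : directed2complex) (p : npath K) (nu : edge K -> Type)
    (Kt : directed2complex) (phi : labelling Kt K) (pt : npath Kt) :
  universal_2cover p phi pt ->
  isomorphic (kernel (theta nu p))
    (diagram_group (K := expansion (fun e : edge Kt => nu (lab_edge phi e))) pt).
Proof.
case=> -[_ _ ptriv] ptp bij.
have cov := squier_covering bij.
have ecov := @squier_covering _ _ (exp_labelling phi nu) pt
  (fun q Dq => exp_triples_bij nu (bij q Dq)).
have pE : cm_vertex (squier_map phi) pt = p by apply: npath_eq.
have epE : cm_vertex (squier_map (exp_labelling phi nu)) pt = p by apply: npath_eq.
have Dpt : parallel pt pt by case: (npathP pt) => x [y ?]; exists x, y.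
apply: (isomorphic_kernel (g := pi1_map epE)).
- exact: pi1_mapM.
- exact: pi1_map_inj ecov _ _ epE Dpt.
elim/pi1_ind=> s; rewrite /in_kernel [theta _ _ _]theta_funE.
split=> [/eqP/loop_classP /= sh|[]].
(* The lift [s'] of a loop in the kernel ends at a vertex [y'] that is not yet known to be [pt]. *)
- have [|s' [y' [ps' s's]]] := covering_path_lift (y := p) ecov Dpt (s := sval s).
    by rewrite epE; apply: svalP s.
  have cs' : map (cm_edge (squier_map phi)) (collapse s') = collapse (sval s).
    by rewrite -s's; apply/esym/collapse_map.
  have [h _] := covering_homot_lift cov sh.
  (* [collapse s'] still ends at [y'] and lifts a null-homotopic loop, so it is homotopic to a lift
     of the empty path. That lift is empty, which forces [y'] to be [pt]. *)
  have [[|//] _ th] := h _ _ _ Dpt pE (collapse_path ps') cs'.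
  have [_ yE] := homot_path th; rewrite -yE in ps'.
  exists (loop_class (Loop ps')); rewrite pi1_mapE.
  by apply/loop_classP; rewrite /= s's; apply: HomotRefl (svalP s).
- elim/pi1_ind=> t; rewrite pi1_mapE => /loop_classP/collapse_homot /= th.
  apply/eqP/loop_classP => /=; apply: HomotTrans (HomotSym th) _.
  rewrite [X in homot _ _ X _]collapse_map.
  (* Conversely, the collapse of a loop [t] upstairs is null-homotopic because the diagram group of
     the 2-cover is trivial; the null-homotopy is then projected by [squier_map phi]. *)
  have /loop_classP th1 := ptriv (loop_class (collapse_loop t)).
  by have := cm_homot (squier_map phi) th1; rewrite pE.
Qed.
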